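(* Let $n\ge1$ and let $(\xi_i,\mathcal{F}_i)_{i=1,\dots,n}$ be martingale differences satisfying $-b\le\xi_i\le1$ for all $i$, for some constant $b>0$. Let $X_k=\sum_{i=1}^k\xi_i$. Then, for any $x\ge0$, $$\mathbb{P}\left(\max_{1\le k\le n}X_k\ge x\right)\le H_n\left(x,\sqrt{nb}\right)$$ and $$\mathbb{P}\left(\max_{1\le k\le n}X_k\ge x\right)\le\exp\left\{-\frac{2x^2}{U_n(x,b)}\right\},$$ where $$U_n(x,b)=\min\left\{n(1+b)^2,\ 4\left(nb+\frac13x\right)\right\}.$$ Both inequalities remain true for supermartingale differences $(\xi_i,\mathcal{F}_i)_{i=1,\dots,n}$ satisfying $-b\le\xi_i\le1$ for all $i$, for some constant $0<b\le1$.
   Context: Setting: $(\Omega,\mathcal{F},\mathbb{P})$ is a probability space and $\{\emptyset,\Omega\}=\mathcal{F}_0\subseteq\mathcal{F}_1\subseteq\dots\subseteq\mathcal{F}_n\subseteq\mathcal{F}$ are increasing $\sigma$-fields. ''Supermartingale differences'' (resp. ''martingale differences'') $(\xi_i,\mathcal{F}_i)_{i=1,\dots,n}$ means that each $\xi_i$ is a real integrable $\mathcal{F}_i$-measurable random variable with $\mathbb{E}(\xi_i|\mathcal{F}_{i-1})\le0$ (resp. $=0$), $i=1,\dots,n$. For $x\ge0$ and $v>0$, $$H_n(x,v)=\left\{\left(\frac{v^2}{x+v^2}\right)^{x+v^2}\left(\frac{n}{n-x}\right)^{n-x}\right\}^{\frac{n}{n+v^2}}\mathbf{1}_{\{x\le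 n\}},$$ with the convention $(+\infty)^0=1$ (which applies when $x=n$); in particular $H_n(x,v)=0$ for $x>n$. *)

(* Defs.v *)
From HB Require Import structures.
From mathcomp Require Import all_boot all_order all_algebra.
From mathcomp Require Import all_classical all_reals all_analysis.

Set Implicit Arguments.
Unset Strict Implicit.
Unset Printing Implicit Defensive.

Import Order.TTheory GRing.Theory Num.Theory.
Import numFieldNormedType.Exports.

Local Open Scope classical_set_scope.
Local Open Scope ring_scope.

(* Sub-sigma-fields are kept as sets of sets, so that a whole filtration can
   live on a single measurable type. *)
Definition is_filtration d (T : measurableType d) (n : nat)
    (F : nat -> set (set T)) : Prop :=
  [/\ F 0%N = [set set0; setT],
      forall i, (i <= n)%N -> sigma_algebra setT (F i),
      forall i, (i < n)%N -> F i `<=` F i.+1 &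
      F n `<=` measurable].

Definition measurable_wrt (T : Type) (R : realType) (G : set (set T))
    (X : T -> R) : Prop :=
  forall B : set R, measurable B -> G (X @^-1` B).

(* [Y] is a version of the conditional expectation of [X] given [G]. *)
Definition is_cond_exp d (T : measurableType d) (R : realType)
    (P : probability T R) (G : set (set T)) (X Y : T -> R) : Prop :=
  [/\ measurable_wrt G Y,
      P.-integrable setT (EFin \o Y) &
      forall A, G A ->
        (\int[P]_(w in A) (Y w)%:E = \int[P]_(w in A) (X w)%:E)%E].

(* The increments are indexed by 1, ..., n; the values of [xi] at other indices
   are irrelevant. *)
Definition adapted_integrable d (T : measurableType d) (R : realType)
    (P : probability T R) (n : nat) (F : nat -> set (set T))
    (xi : nat -> T -> R) : Prop :=
  forall i, (1 <= i <= n)%N ->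
    P.-integrable setT (EFin \o xi i) /\ measurable_wrt (F i) (xi i).

(* Versions of a conditional expectation agree almost surely, so asking for
   one version with the given sign is the same as asking for all of them. *)
Definition martingale_differences d (T : measurableType d) (R : realType)
    (P : probability T R) (n : nat) (F : nat -> set (set T))
    (xi : nat -> T -> R) : Prop :=
  adapted_integrable P n F xi /\
  forall i, (1 <= i <= n)%N ->
    exists2 Y, is_cond_exp P (F i.-1) (xi i) Y & {ae P, forall w, Y w = 0}.

Definition supermartingale_differences d (T : measurableType d)
    (R : realType) (P : probability T R) (n : nat) (F : nat -> set (set T))
    (xi : nat -> T -> R) : Prop :=
  adapted_integrable P n F xi /\
  forall i, (1 <= i <= n)%N ->
    exists2 Y, is_cond_exp P (F i.-1) (xi i) Y & {ae P, forall w, Y w <= 0}.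

Definition partial_sum (T : Type) (R : realType) (xi : nat -> T -> R)
    (k : nat) (w : T) : R :=
  \sum_(1 <= i < k.+1) xi i w.

(* For [1 <= n] the neutral element [X 1 w] is one of the terms, so this is
   exactly the maximum of [X 1 w, ..., X n w]. *)
Definition running_max (T : Type) (R : realType) (X : nat -> T -> R)
    (n : nat) (w : T) : R :=
  \big[Num.max/X 1%N w]_(1 <= k < n.+1) X k w.

(* At [x = n] division by zero gives [n / (n - x) = 0], and [0 `^ 0 = 1], so
   the second factor is 1 as required by the convention (+oo)^0 = 1. *)
Definition hoeffdingH (R : realType) (n : nat) (x v : R) : R :=
  (((v ^+ 2 / (x + v ^+ 2)) `^ (x + v ^+ 2) *
    (n%:R / (n%:R - x)) `^ (n%:R - x)) `^ (n%:R / (n%:R + v ^+ 2)))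
  * (x <= n%:R)%R%:R.

Definition hoeffdingU (R : realType) (n : nat) (x b : R) : R :=
  Num.min (n%:R * (1 + b) ^+ 2) (4 * (n%:R * b + 3^-1 * x)).

(* Main.v *)
(** On [-b, 1] the exponential [expR (l * y)] lies below its chord, which is
    affine with a nonnegative slope; so conditionally on the past
    [expR (l * xi i)] has mean at most [M(l)], the moment generating function of
    the centred law on {-b, 1}, for martingale and for supermartingale
    differences alike. Freezing the process when it first reaches [x] gives
    [P (max X_k >= x) <= expR (- l x) * M(l) ^ n] for all [l >= 0].
    Optimizing over [l] (letting [l] tend to infinity when [x >= n]) yields
    exactly [H_n(x, sqrt (n b))]; Hoeffding's bound
    [M(l) <= expR (l^2 (1 + b)^2 / 8)] and Bennett's bound
    [M(l) <= expR (b (expR l - 1 - l))] with explicit choices of [l] yield the two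
    terms of the minimum [U_n(x, b)]. *)

Require Import Defs.
From HB Require Import structures.
From mathcomp Require Import all_boot all_order all_algebra.
From mathcomp Require Import all_classical all_reals all_analysis.
From mathcomp Require Import measurable_realfun ring lra.

Set Implicit Arguments.
Unset Strict Implicit.
Unset Printing Implicit Defensive.

Import Order.TTheory GRing.Theory Num.Theory.
Import numFieldNormedType.Exports.

Local Open Scope classical_set_scope.
Local Open Scope ring_scope.

(** * Exponential inequalities from the sign of derivatives *)

Lemma ge0_of_derive_ge0 (R : realType) (f f' : R -> R) :
  (forall t, is_derive t (1 : R) f (f' t)) -> 0 <= f 0 ->
  (forall t, 0 <= t -> 0 <= f' t) -> forall t, 0 <= t -> 0 <= f t.
Proof.
move=> fd f0 f'0 t t0; apply: le_trans f0 _.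
apply: (ger0_derive1_ndecry (a := 0)) => //.
- by move=> u; rewrite in_itv /= andbT derive1E derive_val => /ltW /f'0.
- apply: continuous_subspaceT => u.
  by apply: differentiable_continuous; apply/derivable1_diffP.
Qed.

Lemma expR_ge_quadratic (R : realType) (t : R) :
  0 <= t -> 1 + t + t ^+ 2 / 2 <= expR t.
Proof.
move=> t0; rewrite -subr_ge0.
apply: (ge0_of_derive_ge0 (f := fun t => expR t - (1 + t + t ^+ 2 / 2))
  (f' := fun t => expR t - (1 + t)) _ _ _ t0).
- by move=> u; apply: is_derive_eq; rewrite /GRing.scale /=; field.
- by rewrite expR0; lra.
- by move=> u _; rewrite subr_ge0 expR_ge1Dx.
Qed.

Lemma expRN_le_quadratic (R : realType) (t : R) :
  0 <= t -> expR (- t) <= 1 - t + t ^+ 2 / 2.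
Proof.
move=> t0; rewrite -subr_ge0.
apply: (ge0_of_derive_ge0 (f := fun t => 1 - t + t ^+ 2 / 2 - expR (- t))
  (f' := fun t => expR (- t) - (1 + - t)) _ _ _ t0).
- by move=> u; apply: is_derive_eq; rewrite /GRing.scale /=; field.
- by rewrite oppr0 expR0; lra.
- by move=> u _; rewrite subr_ge0 expR_ge1Dx.
Qed.

(** Two differentiations leave a positive multiple of [1 - (1 - t) * expR t], which is nonnegative
    because [1 - t <= expR (- t)]. This turns Bennett's exponent into Bernstein's quadratic one. *)
Lemma bernstein_expR (R : realType) (t : R) : 0 <= t ->
  (1 - t / 3) * (expR t - 1 - t) <= t ^+ 2 / 2.
Proof.
move=> t0; rewrite -subr_ge0.
apply: (ge0_of_derive_ge0
  (f := fun t => t ^+ 2 / 2 - (1 - t / 3) * (expR t - 1 - t))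
  (f' := fun t => (t + 2 - (2 - t) * expR t) / 3) _ _ _ t0).
- by move=> u; apply: is_derive_eq; rewrite /GRing.scale /=; field.
- by rewrite expR0; lra.
move=> {t0}t t0; apply: divr_ge0 => //.
apply: (ge0_of_derive_ge0
  (f := fun t => t + 2 - (2 - t) * expR t)
  (f' := fun t => 1 - (1 - t) * expR t) _ _ _ t0).
- by move=> u; apply: is_derive_eq; rewrite /GRing.scale /=; field.
- by rewrite expR0; lra.
- move=> u _; rewrite subr_ge0 -ler_pdivlMr ?expR_gt0// div1r -expRN.
  exact: expR_ge1Dx.
Qed.

(** Hoeffding's lemma for a Bernoulli law. The difference of the logarithms vanishes at 0 together
    with its derivative, and its second derivative is [4^-1 - r * (1 - r)], where
    [r = p * expR t / D t] is the tilted success probability. *)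
Lemma two_point_mgf_le_gaussian (R : realType) (p h : R) :
  0 <= p <= 1 -> 0 <= h ->
  1 - p + p * expR h <= expR (p * h + h ^+ 2 / 8).
Proof.
move=> /andP[p0 p1] h0.
pose D t := 1 - p + p * expR t.
have D0 t : 0 < D t.
  have := expR_gt0 t; rewrite /D => e0.
  have [->|pn1] := eqVneq p 1; first by rewrite subrr add0r mul1r.
  by rewrite ltr_wpDr ?mulr_ge0 ?(ltW e0)// subr_gt0 lt_neqAle pn1.
have -> : 1 - p + p * expR h = expR (ln (D h)) by rewrite lnK// posrE.
rewrite ler_expR -subr_ge0.
apply: (ge0_of_derive_ge0
  (f := fun t => p * t + t ^+ 2 / 8 - ln (D t))
  (f' := fun t => p + t / 4 - p * expR t / D t) _ _ _ h0).
- move=> u.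
  have lnD : is_derive (D u) (1 : R) (@ln R) (D u)^-1 by exact: is_derive1_ln.
  have dD : is_derive u (1 : R) D (p * expR u).
    by rewrite /D; apply: is_derive_eq; rewrite /GRing.scale /=; field.
  have dlnD : is_derive u (1 : R) (fun t => ln (D t)) (p * expR u / D u).
    by apply: is_derive_eq; rewrite /GRing.scale/= mulrC.
  apply: is_derive_eq; rewrite /GRing.scale /=; field.
  by rewrite gt_eqF.
- by rewrite /D expR0 mulr1 subrK ln1; lra.
move=> {h0}h h0.
apply: (ge0_of_derive_ge0
  (f := fun t => p + t / 4 - p * expR t / D t)
  (f' := fun t => 4^-1 - (1 - p) * (p * expR t) / (D t) ^+ 2) _ _ _ h0).
- move=> u.
  have dD : is_derive u (1 : R) D (p * expR u).
    by rewrite /D; apply: is_derive_eq; rewrite /GRing.scale /=; field.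
  have dV := is_deriveV (lt0r_neq0 (D0 u)) dD.
  apply: is_derive_eq; rewrite /GRing.scale /=.
  have := D0 u; rewrite {1}/D => /lt0r_neq0 Dn.
  by rewrite /D; field.
- by rewrite /D expR0 mulr1 subrK; lra.
(* AM-GM for the two summands [1 - p] and [p * e] of [D u]: four times their product is at most the
   square of their sum. *)
- move=> u _; rewrite subr_ge0 ler_pdivrMr ?exprn_gt0//.
  by rewrite /D -subr_ge0; set e := expR u; have := sqr_ge0 (1 - p - p * e); lra.
Qed.

(** * The centred two-point law on {-b, 1} *)

(** Mean of [expR (l * y)] under the masses [1 / (1 + b)] at [- b] and [b / (1 + b)] at 1, the
    weights that make the law centred. *)
Definition two_point_mgf (R : realType) (b l : R) : R :=
  (expR (- (l * b)) + b * expR l) / (1 + b).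

(** Jensen's inequality for a centred law, through tangent lines at 0. Besides positivity, it lets a
    frozen process satisfy the same one-step bound as a running one. *)
Lemma two_point_mgf_ge1 (R : realType) (b l : R) :
  0 < b -> 1 <= two_point_mgf b l.
Proof.
move=> b0; rewrite /two_point_mgf ler_pdivlMr ?mul1r ?addr_gt0//.
have := expR_ge1Dx (- (l * b)).
have := ler_wpM2l (ltW b0) (expR_ge1Dx l).
by lra.
Qed.

Lemma two_point_mgf_le_expR (R : realType) (b l : R) :
  0 < b -> 0 <= l -> two_point_mgf b l <= expR l.
Proof.
move=> b0 l0; rewrite /two_point_mgf ler_pdivrMr ?addr_gt0//.
have : expR (- (l * b)) <= expR l.
  by rewrite ler_expR; have := mulr_ge0 l0 (ltW b0); lra.
by lra.
Qed.

(** Shifting the law by [b] and scaling by [1 + b] gives a Bernoulli law with [p = b / (1 + b)],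
    taken at [h = l * (1 + b)]; the shift cancels the linear term [p * h]. *)
Lemma two_point_mgf_hoeffding (R : realType) (b l : R) : 0 < b -> 0 <= l ->
  two_point_mgf b l <= expR (l ^+ 2 * (1 + b) ^+ 2 / 8).
Proof.
move=> b0 l0; have b1 : 0 < 1 + b by rewrite addr_gt0.
have p01 : 0 <= b / (1 + b) <= 1.
  by apply/andP; split; [rewrite divr_ge0 ?ltW|rewrite ler_pdivrMr// mul1r lerDr].
have := two_point_mgf_le_gaussian p01 (mulr_ge0 l0 (ltW b1)).
rewrite -(ler_pM2l (expR_gt0 (- (l * b)))) -expRD.
have -> : - (l * b) + (b / (1 + b) * (l * (1 + b)) + (l * (1 + b)) ^+ 2 / 8) =
  l ^+ 2 * (1 + b) ^+ 2 / 8 by field; rewrite gt_eqF.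
apply: le_trans; rewrite le_eqVlt; apply/orP; left; apply/eqP.
have E : expR l = expR (- (l * b)) * expR (l * (1 + b)).
  by rewrite -expRD; congr expR; ring.
by rewrite /two_point_mgf E; field; rewrite gt_eqF.
Qed.

(** It suffices to bound by [1 + b * (expR l - 1 - l)]. With the denominator cleared, this reads
    [expR (- (l * b)) <= 1 - l * b + b ^+ 2 * (expR l - 1 - l)], and [b ^+ 2 * l ^+ 2 / 2] separates
    the two sides. *)
Lemma two_point_mgf_bennett (R : realType) (b l : R) : 0 < b -> 0 <= l ->
  two_point_mgf b l <= expR (b * (expR l - 1 - l)).
Proof.
move=> b0 l0; apply: le_trans (expR_ge1Dx _).
rewrite /two_point_mgf ler_pdivrMr ?addr_gt0//.
have := expR_ge_quadratic l0.
have := expRN_le_quadratic (mulr_ge0 l0 (ltW b0)).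
rewrite exprMn.
set e := expR l; set f := expR _ => h1 h2.
have : b ^+ 2 * (1 + l + l ^+ 2 / 2) <= b ^+ 2 * e by rewrite ler_wpM2l ?sqr_ge0.
by lra.
Qed.

(** * Optimization over the exponential parameter *)

(** Here [q] stands for the probability to be bounded. Each term of the minimum yields a valid
    bound, whichever is the smaller. *)
Lemma le_hoeffdingU (R : realType) (n : nat) (b x q : R) :
  (0 < n)%N -> 0 < b -> 0 <= x ->
  (forall l, 0 <= l -> q <= expR (- (l * x)) * two_point_mgf b l ^+ n) ->
  q <= expR (- (2 * x ^+ 2 / hoeffdingU n x b)).
Proof.
move=> n0 b0 x0 qle; have n0' : 0 < n%:R :> R by rewrite ltr0n.
have M0 l : 0 < two_point_mgf b l.
  exact: lt_le_trans ltr01 (two_point_mgf_ge1 _ b0).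
rewrite /hoeffdingU /Order.min; case: ifP => _.
(* The minimizer of [- (l * x) + n%:R * (l ^+ 2 * (1 + b) ^+ 2 / 8)]. *)
- pose l := 4 * x / (n%:R * (1 + b) ^+ 2).
  have l0 : 0 <= l by apply: divr_ge0; apply: mulr_ge0 => //; rewrite ?ler0n ?sqr_ge0.
  apply: le_trans (qle _ l0) _.
  have := two_point_mgf_hoeffding b0 l0.
  rewrite -(ler_pXn2r n0) ?nnegrE ?expR_ge0 ?(ltW (M0 _))// -expRM_natl.
  rewrite -(ler_pM2l (expR_gt0 (- (l * x)))) -expRD => /le_trans -> //.
  rewrite ler_expR le_eqVlt; apply/orP; left; apply/eqP.
  by rewrite /l; field; rewrite !gt_eqF ?addr_gt0.
(* With [l = x / V] the Bernstein factor [1 - l / 3] equals [n%:R * b / V], so the Bennett exponent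
   is at most [x ^+ 2 / V / 2], half of the gain [l * x]. *)
- pose V := n%:R * b + x / 3.
  have V0 : 0 < V by rewrite ltr_wpDr ?mulr_gt0// divr_ge0 ?ler0n.
  pose l := x / V.
  have l0 : 0 <= l by rewrite divr_ge0// ltW.
  apply: le_trans (qle _ l0) _.
  have := two_point_mgf_bennett b0 l0.
  rewrite -(ler_pXn2r n0) ?nnegrE ?expR_ge0 ?(ltW (M0 _))// -expRM_natl.
  rewrite -(ler_pM2l (expR_gt0 (- (l * x)))) -expRD => /le_trans -> //.
  rewrite ler_expR.
  have : n%:R * (b * (expR l - 1 - l)) <= x ^+ 2 / V / 2.
    have := bernstein_expR l0.
    have -> : 1 - l / 3 = n%:R * b / V.
      rewrite (_ : n%:R * b = V - x / 3) /l; last by rewrite /V; ring.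
      by field; rewrite gt_eqF.
    rewrite -(ler_pM2l V0) mulrA => /le_trans H.
    have -> : n%:R * b * (expR l - 1 - l) =
        V * (n%:R * b / V * (expR l - 1 - l)) by field; rewrite gt_eqF.
    apply: H; rewrite le_eqVlt; apply/orP; left; apply/eqP.
    by rewrite /l; field; rewrite gt_eqF.
  move=> H; rewrite -lerBrDl; apply: le_trans H _.
  rewrite (mulrC 3^-1) -/V le_eqVlt; apply/orP; left; apply/eqP.
  by rewrite /l; field; rewrite gt_eqF.
Qed.

Lemma le_hoeffdingH (R : realType) (n : nat) (b x q : R) :
  (0 < n)%N -> 0 < b -> 0 <= x ->
  (forall l, 0 <= l -> q <= expR (- (l * x)) * two_point_mgf b l ^+ n) ->
  q <= hoeffdingH n x (Num.sqrt (n%:R * b)).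
Proof.
move=> n0 b0 x0 qle; have n0' : 0 < n%:R :> R by rewrite ltr0n.
have b1 : 0 < 1 + b by rewrite addr_gt0.
have nb0 : 0 < n%:R * b by rewrite mulr_gt0.
have M0 l : 0 < two_point_mgf b l.
  exact: lt_le_trans ltr01 (two_point_mgf_ge1 _ b0).
rewrite /hoeffdingH sqr_sqrtr ?(ltW nb0)//.
have -> : n%:R / (n%:R + n%:R * b) = (1 + b)^-1.
  by field; rewrite !gt_eqF// addr_gt0.
have [xn|xn|xn] := ltgtP x n%:R; rewrite ?mulr1 ?mulr0.
- have nx : 0 < n%:R - x by rewrite subr_gt0.
  have xnb : 0 < x + n%:R * b by rewrite ltr_wpDl.
  pose A : R := n%:R * b / (x + n%:R * b).
  pose B : R := n%:R / (n%:R - x).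
  have A0 : 0 < A by rewrite divr_gt0.
  have B0 : 0 < B by rewrite divr_gt0.
  (* The stationary point in [l]: [expR (l * (1 + b)) = B / A]. It is nonnegative since
     [A <= 1 <= B], and there the moment generating function is [expR (- (l * b)) * B]. *)
  pose l := ln (B / A) / (1 + b).
  have l0 : 0 <= l.
    apply: divr_ge0; last exact: ltW.
    apply: ln_ge0; rewrite ler_pdivlMr// mul1r.
    apply: (@le_trans _ _ 1).
      by rewrite ler_pdivrMr// mul1r lerDr.
    by rewrite ler_pdivlMr// mul1r gerBl.
  apply: le_trans (qle _ l0) _.
  have Ml : two_point_mgf b l = expR (- (l * b)) * B.
    rewrite /two_point_mgf.
    have -> : expR l = expR (- (l * b)) * (B / A).
      rewrite -[B / A]lnK ?posrE ?divr_gt0// -expRD; congr expR.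
      by rewrite /l; field; rewrite gt_eqF.
    by rewrite /B /A; field; rewrite !gt_eqF.
  rewrite Ml /powR -/A -/B (gt_eqF A0) (gt_eqF B0) mulf_eq0 !expR_eq0 /=.
  rewrite lnM ?posrE ?expR_gt0// !expRK.
  rewrite exprMn -expRM_natl -[X in X ^+ n](lnK (x := B)) ?posrE// -expRM_natl.
  rewrite -!expRD ler_expR le_eqVlt; apply/orP; left; apply/eqP.
  rewrite /l ln_div ?posrE//; field; rewrite gt_eqF//.
(* For [x > n] the bound is 0. If [q > 0], the choice [l = (q * (x - n%:R))^-1] makes the right side
   at most [expR (- q^-1)], which is less than [q]. *)
- rewrite leNgt; apply/negP => q0.
  have xn0 : 0 < x - n%:R by rewrite subr_gt0.
  have l0 : 0 <= (q * (x - n%:R))^-1 by rewrite invr_ge0 ltW ?mulr_gt0.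
  have := qle _ l0; apply/negP; rewrite -ltNge.
  set l := _^-1.
  apply: (@le_lt_trans _ _ (expR (- (l * x)) * expR l ^+ n)).
    rewrite ler_wpM2l ?expR_ge0//; apply: lerXn2r; rewrite ?nnegrE ?expR_ge0//.
      exact: ltW.
    exact: two_point_mgf_le_expR.
  rewrite -expRM_natl -expRD.
  have -> : - (l * x) + n%:R * l = - q^-1.
    by rewrite /l; field; rewrite !gt_eqF.
  rewrite expRN -[ltRHS]invrK ltf_pV2 ?posrE ?expR_gt0 ?invr_gt0//.
  by apply: lt_le_trans (expR_ge1Dx _); rewrite ltrDr.
- rewrite xn subrr powRr0 mulr1 -powRrM.
  have -> : (n%:R + n%:R * b) / (1 + b) = n%:R by field; rewrite gt_eqF.
  rewrite powR_mulrn; last by rewrite divr_ge0 ?addr_ge0 ?ltW.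
  have -> : n%:R * b / (n%:R + n%:R * b) = (0 + b) / (1 + b).
    by field; rewrite !gt_eqF// addr_gt0.
  (* For [x = n] the infimum is only approached as [l] grows. Along [l = k%:R / (1 + b)] the bound
     is exactly this sequence, with [- k%:R = - (l * (1 + b))]. *)
  have cv : ((expR (- k%:R) + b) / (1 + b)) ^+ n @[k --> \oo] -->
      ((0 + b) / (1 + b) : R) ^+ n.
    apply: (@cvg_comp _ _ _ _ (fun y : R => y ^+ n)); last exact: exprn_continuous.
    apply: cvgMr_tmp; apply: cvgD; [exact: cvgn_expR|exact: cvg_cst].
  apply: (cvgr_to_ge cv); apply: nearW => k.
  have l0 : 0 <= k%:R / (1 + b) by rewrite divr_ge0 ?ler0n ?ltW.
  apply: le_trans (qle _ l0) _; set l := _ / _.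
  rewrite xn mulrC -mulNr expRM_natr -exprMn.
  rewrite le_eqVlt; apply/orP; left; apply/eqP; congr (_ ^+ n).
  have -> : - k%:R = - l + - (l * b).
    by rewrite /l; field; rewrite gt_eqF.
  by rewrite expRD /two_point_mgf !expRN; field; rewrite !gt_eqF ?expR_gt0.
Qed.

(** * Integrals against weights measurable for a sub-sigma-field *)

(** The sum counts the positive integers up to [y], hence is its integer part. *)
Lemma count_thresholds (R : realType) (K : nat) (y : R) : 0 <= y <= K%:R ->
  y - 1 <= \sum_(j < K) (j.+1%:R <= y)%R%:R <= y.
Proof.
elim: K => [|K IH] /andP[y0 yK]; first by rewrite big_ord0; lra.
rewrite big_ord_recr /=; have [yK'|Ky] := leP y K%:R.
  rewrite [_ <= y]leNgt (le_lt_trans yK') ?ltr_nat// addr0.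
  by apply: IH; rewrite y0.
rewrite (eq_bigr (fun=> 1)) => [|j _]; last first.
  by rewrite (le_trans _ (ltW Ky))// ler_nat.
rewrite sumr_const card_ord -/(K%:R).
move: yK; rewrite -natr1 => yK.
by case: (leP (K%:R + 1) y) => /=; lra.
Qed.

Section predictable_weight.
Context d (T : measurableType d) (R : realType) (P : probability T R).

Lemma bounded_RV_integrable (f : T -> R) (C : R) :
  measurable_fun setT f -> (forall w, `|f w| <= C) ->
  P.-integrable setT (EFin \o f).
Proof.
move=> mf fC; apply: measurable_bounded_integrable => //.
  by rewrite (le_lt_trans (probability_le1 P measurableT)) ?ltry.
by exists C; split; [exact: num_real|move=> M CM w _; exact: le_trans (fC w) (ltW CM)].
Qed.

Lemma measurable_wrt_le (G G' : set (set T)) (f : T -> R) :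
  G `<=` G' -> measurable_wrt G f -> measurable_wrt G' f.
Proof. by move=> GG' fG B mB; apply/GG'/fG. Qed.

(** Makes the closure properties of measurable functions available for a sub-sigma-field, seen as
    the sigma-algebra of a measurable type of its own. *)
Lemma measurable_wrtP (G : set (set T)) (f : T -> R) : sigma_algebra setT G ->
  measurable_wrt G f <->
  measurable_fun setT (f : g_sigma_algebraType G -> R).
Proof.
move=> sG; split => [fG _ B mB|mf B mB].
  by rewrite setTI measurable_g_measurableTypeE//; exact: fG.
have := mf measurableT B mB.
by rewrite setTI measurable_g_measurableTypeE.
Qed.

(** Plays the role of pulling a known factor out of a conditional expectation. [W] is within
    [1 / m.+1] of a nonnegative combination of indicators of sets in [G], so the integral is at most
    [D / m.+1] for every [m]. *)
Lemma Rintegral_weight_le0 (G : set (set T)) (W xi : T -> R) (C D : R) :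
  G `<=` measurable -> measurable_wrt G W -> (forall w, 0 <= W w <= C) ->
  measurable_fun setT xi -> (forall w, `|xi w| <= D) ->
  (forall A, G A -> \int[P]_(w in A) xi w <= 0) ->
  \int[P]_w (W w * xi w) <= 0.
Proof.
move=> Gm WG WC mxi xiD xiG.
have D0 : 0 <= D by apply: le_trans (xiD point).
have mW : measurable_fun setT W.
  by move=> _ B mB; rewrite setTI; apply/Gm/WG.
(* [S] below is the floor of [m.+1 * W], a sum of indicators of level sets of
   [W]; each level set lies in [G]. *)
suff H m : m.+1%:R * \int[P]_w (W w * xi w) <= D.
  rewrite leNgt; apply/negP => I0.
  have := truncnS_gt (D / \int[P]_w (W w * xi w)).
  by rewrite ltr_pdivrMr// ltNge H.
have m0 : 0 < m.+1%:R :> R by rewrite ltr0n.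
have [K CK] : exists K, m.+1%:R * C <= K%:R.
  exists (Num.truncn (m.+1%:R * C)).+1; apply/ltW.
  by rewrite truncnS_gt.
pose A (j : nat) := W @^-1` `[j.+1%:R / m.+1%:R, +oo[.
have GA j : G (A j) by apply: WG; exact: measurable_itv.
have mA j : measurable (A j) by exact: Gm.
pose S w := \sum_(j < K) (\1_(A j) w : R).
have SW w : m.+1%:R * W w - 1 <= S w <= m.+1%:R * W w.
  have -> : S w = \sum_(j < K) (j.+1%:R <= m.+1%:R * W w)%R%:R.
    apply: eq_bigr => j _; rewrite indicE; congr (_%:R); congr nat_of_bool.
    by rewrite /A; apply/idP/idP; rewrite inE /= in_itv /= andbT ler_pdivrMr// mulrC.
  have /andP[W0 WC'] := WC w.
  apply: count_thresholds; rewrite mulr_ge0//= (le_trans _ CK)// ler_pM2l//.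
have iA j : P.-integrable setT (EFin \o (fun w => \1_(A j) w * xi w)).
  apply: (bounded_RV_integrable (C := D)).
    by apply: measurable_funM => //; exact: measurable_indic.
  move=> w; rewrite normrM indicE; case: (_ \in _).
    by rewrite normr1 mul1r.
  by rewrite normr0 mul0r.
have IA j : \int[P]_w (\1_(A j) w * xi w) <= 0.
  apply: le_trans (xiG _ (GA j)); rewrite [leRHS]Rintegral_mkcond.
  by rewrite patch_indic; under eq_Rintegral do rewrite /= mulrC.
have SE w : (S w * xi w)%:E = (\sum_(j < K) (\1_(A j) w * xi w)%:E)%E.
  by rewrite sumEFin mulr_suml.
have iS : P.-integrable setT (EFin \o (fun w => S w * xi w)).
  rewrite (_ : EFin \o _ = fun w => (\sum_(j < K) (\1_(A j) w * xi w)%:E)%E).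
    by apply: integrable_sum => // j _; exact: iA.
  by apply/funext => w; rewrite /= SE.
have IS : \int[P]_w (S w * xi w) <= 0.
  rewrite /Rintegral; under eq_integral do rewrite SE.
  rewrite integral_sum//; last by move=> j; exact: iA.
  rewrite -sum_fine => [|j _]; last by apply: integrable_fin_num => //; exact: iA.
  by apply: sumr_le0 => j _; exact: IA.
have iW : P.-integrable setT (EFin \o (fun w => W w * xi w)).
  apply: (bounded_RV_integrable (C := C * D)); first exact: measurable_funM.
  by move=> w; have /andP[W0 WC'] := WC w; rewrite normrM ger0_norm// ler_pM.
rewrite -RintegralZl//.
have iD : P.-integrable setT (EFin \o (cst D : T -> R)).
  exact: finite_measure_integrable_cst.
(* Rounding [m.+1%:R * W] to [S] costs at most 1, so multiplication by [xi] changes the integrand by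
   at most [D]; the total mass is 1. *)
apply: (@le_trans _ _ (\int[P]_w (S w * xi w + D))); last first.
  rewrite RintegralD// Rintegral_cst// [X in fine X](_ : _ = 1%E);
    last exact: probability_setT.
  by rewrite mulr1 gerDr.
apply: le_Rintegral => //.
- exact: (integrableZl measurableT m.+1%:R iW).
- exact: (integrableD measurableT iS iD).
- move=> w _; rewrite mulrA -lerBlDl -mulrBl.
  have /andP[S1 S2] := SW w.
  apply: le_trans (ler_norm _) _; rewrite normrM.
  by rewrite -[D]mul1r ler_pM// ger0_norm; lra.
Qed.
End predictable_weight.

(** * Filtrations, first passage and measurability of the maximum *)

Lemma filtration_le d (T : measurableType d) (n : nat)
    (F : nat -> set (set T)) : is_filtration n F ->
  forall i k, (i <= k <= n)%N -> F i `<=` F k.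
Proof.
move=> [_ _ Fn _] i; elim=> [|k IH]; first by case: i => // _; exact: subset_refl.
move=> /andP[]; rewrite leq_eqVlt ltnS => /predU1P[->|ik] kn.
  exact: subset_refl.
by apply: subset_trans (Fn _ kn); apply: IH; rewrite ik ltnW.
Qed.

(** Times start at 1, so the condition is true at [k = 0] even when [x = 0]; the stopped process
    therefore starts at 1. A boolean form allows branching on it. *)
Definition stays_below (T : Type) (R : realType) (X : nat -> T -> R) (x : R)
    (k : nat) (w : T) : bool := all (fun j => X j w < x) (iota 1 k).

Lemma stays_belowS (T : Type) (R : realType) (X : nat -> T -> R) x k w :
  stays_below X x k.+1 w = stays_below X x k w && (X k.+1 w < x).
Proof. by rewrite /stays_below -[in LHS](addn1 k) iotaD all_cat /= andbT add1n. Qed.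

Lemma running_max_lt (T : Type) (R : realType) (X : nat -> T -> R) x n w :
  (1 <= n)%N -> (running_max X n w < x) = stays_below X x n w.
Proof.
move=> n1; rewrite /running_max /stays_below /index_iota subSS subn0.
apply/idP/allP => [mx j jn|h].
  by apply: le_lt_trans mx; exact: le_bigmax_seq.
rewrite big_seq; apply: bigmax_lt => [|j jn]; apply: h => //.
by rewrite mem_iota.
Qed.

(** Applied both to the ambient sigma-algebra and to the one generated by [F k]. *)
Lemma measurable_stays_below d (T : measurableType d) (R : realType)
    (X : nat -> T -> R) (x : R) (k : nat) :
  (forall j, (1 <= j <= k)%N -> measurable_fun setT (X j)) ->
  measurable_fun setT (stays_below X x k).
Proof.
elim: k => [|k IH] mX; first exact: measurable_cst.
rewrite (_ : stays_below _ _ _ =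
    fun w => stays_below X x k w && (X k.+1 w < x)); last first.
  by apply/funext => w; rewrite stays_belowS.
apply: measurable_and.
  by apply: IH => j /andP[j1 jk]; apply: mX; rewrite j1 ltnW.
by apply: measurable_fun_ltr; [apply: mX; rewrite leqnn|exact: measurable_cst].
Qed.

Lemma partial_sum0 (T : Type) (R : realType) (xi : nat -> T -> R) w :
  partial_sum xi 0 w = 0.
Proof. by rewrite /partial_sum big_geq. Qed.

Lemma partial_sumS (T : Type) (R : realType) (xi : nat -> T -> R) k w :
  partial_sum xi k.+1 w = partial_sum xi k w + xi k.+1 w.
Proof. by rewrite /partial_sum big_nat_recr. Qed.

Lemma measurable_partial_sum d (T : measurableType d) (R : realType)
    (xi : nat -> T -> R) (k : nat) :
  (forall j, (1 <= j <= k)%N -> measurable_fun setT (xi j)) ->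
  measurable_fun setT (partial_sum xi k).
Proof.
elim: k => [|k IH] mX.
  rewrite (_ : partial_sum _ _ = cst 0); first exact: measurable_cst.
  by apply/funext => w; rewrite partial_sum0.
rewrite (_ : partial_sum _ _ = partial_sum xi k \+ xi k.+1); last first.
  by apply/funext => w; rewrite partial_sumS.
apply: measurable_funD; last by apply: mX; rewrite leqnn.
by apply: IH => j /andP[j1 jk]; apply: mX; rewrite j1 ltnW.
Qed.

Lemma measurable_running_max_ge d (T : measurableType d) (R : realType)
    (xi : nat -> T -> R) (n : nat) (x : R) : (1 <= n)%N ->
  (forall i, (1 <= i <= n)%N -> measurable_fun setT (xi i)) ->
  measurable [set w | (x <= running_max (partial_sum xi) n w)%R].
Proof.
move=> n1 mxi; rewrite (_ : mkset _ = stays_below (partial_sum xi) x n @^-1` [set false]).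
  rewrite -[X in measurable X]setTI; apply: measurable_stays_below => //.
  move=> j /andP[j1 jn]; apply: measurable_partial_sum => i /andP[i1 ij].
  by apply: mxi; rewrite i1 (leq_trans ij).
apply/funext => w /=; apply/propext; rewrite leNgt running_max_lt//.
by split => [/negbTE|->].
Qed.

(** * The chord bound and the stopped exponential process *)

(** Convexity: the right side is the chord over [-b, 1]. Its value at 0 is the two-point moment
    generating function because that law is centred. *)
Lemma expR_le_chord (R : realType) (b l y : R) : 0 < b -> -b <= y <= 1 ->
  expR (l * y) <=
  two_point_mgf b l + (expR l - expR (- (l * b))) / (1 + b) * y.
Proof.
move=> b0 /andP[yb y1]; have b1 : 0 < 1 + b by rewrite addr_gt0.
have -> : two_point_mgf b l + (expR l - expR (- (l * b))) / (1 + b) * y =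
    ((1 - y) * expR (- (l * b)) + (y + b) * expR l) / (1 + b).
  by rewrite /two_point_mgf; field; rewrite gt_eqF.
rewrite ler_pdivlMr//.
(* both endpoint values are bounded below by the tangent line at [l * y] *)
have tangent u : expR (l * y) * (1 + (u - l * y)) <= expR u.
  rewrite -[leRHS](_ : expR (l * y) * expR (u - l * y) = _); last first.
    by rewrite -expRD; congr expR; ring.
  by rewrite ler_wpM2l ?expR_ge0// expR_ge1Dx.
have y1' : 0 <= 1 - y by rewrite subr_ge0.
have yb' : 0 <= y + b by rewrite -lerBlDr sub0r.
have := ler_wpM2l y1' (tangent (- (l * b))).
have := ler_wpM2l yb' (tangent l).
by set e := expR (l * y); lra.
Qed.

Section maximal_inequality.
Context d (T : measurableType d) (R : realType) (P : probability T R).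
Context (n : nat) (F : nat -> set (set T)) (xi : nat -> T -> R) (b : R).
Hypothesis F_filtration : is_filtration n F.
Hypothesis b_gt0 : 0 < b.
Hypothesis xi_adapted : forall i, (1 <= i <= n)%N -> measurable_wrt (F i) (xi i).
Hypothesis xi_bounded : forall i w, (1 <= i <= n)%N -> - b <= xi i w <= 1.
Hypothesis xi_le0 : forall i, (1 <= i <= n)%N ->
  forall A, F i.-1 A -> \int[P]_(w in A) xi i w <= 0.
Context (x l : R).
Hypothesis l_ge0 : 0 <= l.

Let X := partial_sum xi.
Let M := two_point_mgf b l.

Let F_measurable k : (k <= n)%N -> F k `<=` measurable.
Proof.
move=> kn; case: (F_filtration) => _ _ _ Fn; apply: subset_trans Fn.
by apply: (filtration_le F_filtration); rewrite kn leqnn.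
Qed.

Let F_algebra k : (k <= n)%N -> sigma_algebra setT (F k).
Proof. by case: F_filtration => _ + _ _; apply. Qed.

Let mX k j : (1 <= j <= k)%N -> (k <= n)%N ->
  measurable_fun setT (xi j : g_sigma_algebraType (F k) -> R).
Proof.
move=> /andP[j1 jk] kn; apply/(measurable_wrtP _ (F_algebra kn)).
apply: (@measurable_wrt_le _ _ _ (F j)).
  by apply: (filtration_le F_filtration); rewrite jk.
by apply: xi_adapted; rewrite j1 (leq_trans jk).
Qed.

(* [c = expR (l * x)] freezes the exponential at the level [x]; [c = 0] gives the
   predictable weight carried by the next increment. *)
Let stopped (c : R) k w :=
  if stays_below X x k w then expR (l * X k w) else c.

Let stopped_wrt (c : R) k : (k <= n)%N -> measurable_wrt (F k) (stopped c k).
Proof.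
move=> kn; apply/(measurable_wrtP _ (F_algebra kn)).
apply: measurable_fun_ifT.
- apply: measurable_stays_below => j /andP[j1 jk].
  apply: measurable_partial_sum => i /andP[i1 ij].
  by apply: mX => //; rewrite i1 (leq_trans ij).
- apply: measurableT_comp => //; apply: measurable_funM => //.
  by apply: measurable_partial_sum => i ?; exact: mX.
- exact: measurable_cst.
Qed.

Let X_le k w : (k <= n)%N -> X k w <= k%:R.
Proof.
elim: k => [|k IH] kn; first by rewrite /X partial_sum0.
rewrite /X partial_sumS -natr1 lerD ?IH ?(ltnW kn)//.
by have /andP[] := xi_bounded w (kn : 1 <= k.+1 <= n)%N.
Qed.

Let stopped_ge0 c k w : 0 <= c -> 0 <= stopped c k w.
Proof. by move=> c0; rewrite /stopped; case: ifP => // _; exact: expR_ge0. Qed.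

Let stopped_le c k w : (k <= n)%N -> 0 <= c -> stopped c k w <= expR (l * k%:R) + c.
Proof.
move=> kn c0; rewrite /stopped; case: ifP => _; last first.
  by rewrite lerDr expR_ge0.
by rewrite -[leLHS]addr0 lerD// ler_expR ler_wpM2l// X_le.
Qed.

Let stopped_measurable c k : (k <= n)%N -> measurable_fun setT (stopped c k).
Proof.
by move=> kn _ B mB; rewrite setTI; apply: (F_measurable kn); exact: stopped_wrt.
Qed.

Let xi_measurable k : (1 <= k <= n)%N -> measurable_fun setT (xi k).
Proof.
move=> kn _ B mB; rewrite setTI.
by have /andP[_ kn'] := kn; apply: (F_measurable kn'); exact: xi_adapted.
Qed.

Let xi_norm k w : (1 <= k <= n)%N -> `|xi k w| <= 1 + b.
Proof.
move=> /(xi_bounded w) /andP[x1 x2]; have := b_gt0; rewrite ler_norml => b0.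
by apply/andP; split; lra.
Qed.

Let stopped_integrable c k : (k <= n)%N -> 0 <= c ->
  P.-integrable setT (EFin \o stopped c k).
Proof.
move=> kn c0; apply: (bounded_RV_integrable P (C := expR (l * k%:R) + c)).
  exact: stopped_measurable.
by move=> w; rewrite ger0_norm ?stopped_ge0// stopped_le.
Qed.

Let stopped_step k w : (k < n)%N ->
  stopped (expR (l * x)) k.+1 w <= M * stopped (expR (l * x)) k w +
    (expR l - expR (- (l * b))) / (1 + b) * (stopped 0 k w * xi k.+1 w).
Proof.
move=> kn; set c := _ / _; set e := expR (l * x).
have chord : expR (l * X k.+1 w) <=
    M * expR (l * X k w) + c * (expR (l * X k w) * xi k.+1 w).
  rewrite /X partial_sumS mulrDr expRD.
  rewrite [leRHS](_ : _ = expR (l * partial_sum xi k w) * (M + c * xi k.+1 w)).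
    by rewrite ler_wpM2l ?expR_ge0// expR_le_chord// xi_bounded.
  by ring.
have eM : e <= M * e by rewrite ler_peMl ?expR_ge0// two_point_mgf_ge1.
rewrite /stopped stays_belowS; case: stays_below => /=; last first.
  by rewrite mul0r mulr0 addr0.
case: ltP => // xX; apply: le_trans chord.
by rewrite ler_expR ler_wpM2l.
Qed.

(** Integrating the one-step bound costs a factor [M] each time: the slope is nonnegative and the
    weight [stopped 0 k] is known at time [k], so the linear term has nonpositive mean. *)
Let stopped_mean k : (k <= n)%N ->
  \int[P]_w stopped (expR (l * x)) k w <= M ^+ k.
Proof.
elim: k => [_|k IH kn].
  rewrite (@eq_Rintegral _ _ _ P setT (cst 1)); last first.
    by move=> w _; rewrite /stopped /= /X partial_sum0 mulr0 expR0.
  rewrite Rintegral_cst// [X in fine X](_ : _ = 1%E) ?mulr1//.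
  exact: probability_setT.
have kn' := ltnW kn.
have M0 : 0 <= M by apply: le_trans ler01 _; exact: two_point_mgf_ge1.
set c := (expR l - expR (- (l * b))) / (1 + b).
have c0 : 0 <= c.
  apply: divr_ge0; last by rewrite addr_ge0// ltW.
  rewrite subr_ge0 ler_expR.
  by rewrite (le_trans _ l_ge0)// oppr_le0 mulr_ge0// ltW.
have iW : P.-integrable setT (EFin \o (fun w => stopped 0 k w * xi k.+1 w)).
  apply: (bounded_RV_integrable P (C := (expR (l * k%:R) + 0) * (1 + b))).
    by apply: measurable_funM; [exact: stopped_measurable|exact: xi_measurable].
  move=> w; rewrite normrM ler_pM// ?xi_norm//.
  by rewrite ger0_norm ?stopped_ge0// stopped_le.
have ig := stopped_integrable kn' (expR_ge0 (l * x)).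
apply: (@le_trans _ _ (M * \int[P]_w stopped (expR (l * x)) k w +
    c * \int[P]_w (stopped 0 k w * xi k.+1 w))).
  rewrite -!RintegralZl// -RintegralD//; first last.
  - exact: (integrableZl measurableT c iW).
  - exact: (integrableZl measurableT M ig).
  apply: le_Rintegral => //.
  - by apply: stopped_integrable => //; exact: expR_ge0.
  - exact: (integrableD measurableT (integrableZl measurableT M ig)
      (integrableZl measurableT c iW)).
  - by move=> w _; exact: stopped_step.
rewrite -[leRHS]addr0 exprS; apply: lerD; first by rewrite ler_wpM2l// IH.
rewrite mulr_ge0_le0//.
apply: (Rintegral_weight_le0 (C := expR (l * k%:R) + 0) (D := 1 + b)
  (F_measurable kn')) => //.
- exact: stopped_wrt.
- by move=> w; rewrite stopped_ge0//= stopped_le.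
- exact: xi_measurable.
- by move=> w; exact: xi_norm.
- by move=> A FA; exact: xi_le0.
Qed.

(** Markov's inequality: on the event the stopped process ends at [expR (l * x)], and elsewhere it
    is nonnegative. *)
Lemma maximal_inequality : (1 <= n)%N ->
  (P [set w | (x <= running_max X n w)%R] <= (expR (- (l * x)) * M ^+ n)%:E)%E.
Proof.
move=> n1; set E := [set w | _].
have EE w : w \in E = ~~ stays_below X x n w.
  by rewrite -running_max_lt// -leNgt; apply/idP/idP; rewrite inE.
have mE : measurable E by exact: measurable_running_max_ge.
rewrite -(fineK (fin_num_measure P _ mE)) lee_fin expRN.
rewrite ler_pdivlMl ?expR_gt0//.
apply: le_trans (stopped_mean (leqnn n)).
have iE : P.-integrable setT (EFin \o (\1_E : T -> R)).
  apply: (bounded_RV_integrable P (C := 1)); first exact: measurable_indic.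
  by move=> w; rewrite indicE; case: (_ \in _); rewrite ?normr1 ?normr0.
have -> : fine (P E) = \int[P]_w (\1_E w).
  by rewrite /Rintegral integral_indic// setIT.
rewrite -RintegralZl//; apply: le_Rintegral => //.
- exact: (integrableZl measurableT (expR (l * x)) iE).
- by apply: stopped_integrable => //; exact: expR_ge0.
- move=> w _; rewrite indicE EE /stopped.
  by case: (stays_below _ _ _ _); rewrite ?mulr0 ?mulr1 ?expR_ge0.
Qed.
End maximal_inequality.

(** * Almost sure bounds, conditional expectations and the conclusion *)

Lemma running_max_eq (T : Type) (R : realType) (xi zeta : nat -> T -> R) n w :
  (forall i, (1 <= i <= n)%N -> xi i w = zeta i w) -> (1 <= n)%N ->
  running_max (partial_sum xi) n w = running_max (partial_sum zeta) n w.
Proof.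
move=> xz n1; have X k : (k <= n)%N -> partial_sum xi k w = partial_sum zeta k w.
  move=> kn; apply: eq_big_nat => i /andP[i1 ik]; apply: xz.
  by rewrite i1 (leq_trans _ kn).
by rewrite /running_max X//; apply: eq_big_nat => k /andP[_ kn]; exact: X.
Qed.

(** Clipping the increments to [-b, 1] changes them only on null sets and makes the bounds hold
    everywhere; being a Borel map, it keeps them adapted. *)
Lemma maximal_inequality_ae d (T : measurableType d) (R : realType)
    (P : probability T R) (n : nat) (F : nat -> set (set T))
    (xi : nat -> T -> R) (b x l : R) :
  (1 <= n)%N -> is_filtration n F -> 0 < b ->
  (forall i, (1 <= i <= n)%N -> {ae P, forall w, - b <= xi i w <= 1}) ->
  supermartingale_differences P n F xi -> 0 <= l ->
  (P [set w | (x <= running_max (partial_sum xi) n w)%R]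
    <= (expR (- (l * x)) * two_point_mgf b l ^+ n)%:E)%E.
Proof.
move=> n1 Ff b0 xib [xia xis] l0.
pose clip (y : R) := Num.max (- b) (Num.min 1 y).
have mclip : measurable_fun setT clip.
  apply: measurable_maxr; first exact: measurable_cst.
  by apply: measurable_minr; [exact: measurable_cst|exact: measurable_id].
have clip_id y : - b <= y <= 1 -> clip y = y.
  by move=> /andP[by_ y1]; rewrite /clip min_r// max_r.
pose zeta i w := clip (xi i w).
have Fm i : (i <= n)%N -> F i `<=` measurable.
  move=> ni; case: (Ff) => _ _ _ Fn; apply: subset_trans Fn.
  by apply: (filtration_le Ff); rewrite ni leqnn.
have mxi i : (1 <= i <= n)%N -> measurable_fun setT (xi i).
  move=> i1n; have /andP[_ ni] := i1n => _ B mB; rewrite setTI.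
  by apply: (Fm _ ni); apply: (xia _ i1n).2.
have mzeta i : (1 <= i <= n)%N -> measurable_fun setT (zeta i).
  by move=> i1n; apply: measurableT_comp => //; exact: mxi.
have zeta_xi i : (1 <= i <= n)%N -> {ae P, forall w, zeta i w = xi i w}.
  by move=> /xib; apply: filterS => w; exact: clip_id.
(* The two events differ by a null set, since the finitely many increments involved agree almost
   surely; their indicators then have equal integrals. *)
have -> : P [set w | (x <= running_max (partial_sum xi) n w)%R] =
          P [set w | (x <= running_max (partial_sum zeta) n w)%R].
  have mE := measurable_running_max_ge x n1 mxi.
  have mE' := measurable_running_max_ge x n1 mzeta.
  rewrite -[X in P X]setIT -[in RHS](setIT (mkset _)).
  rewrite -!integral_indic//; apply: ae_eq_integral => //.
  - by apply/measurable_EFinP; exact: measurable_indic.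
  - by apply/measurable_EFinP; exact: measurable_indic.
  have /ae_foralln : forall i, {ae P, forall w, (1 <= i <= n)%N -> zeta i w = xi i w}.
    move=> i; have [i1n|_] := boolP (1 <= i <= n)%N; last exact: aeW.
    by apply: filterS (zeta_xi _ i1n) => w ->.
  apply: filterS => w zx _; congr (_%:E); rewrite !indicE; congr (_%:R).
  congr nat_of_bool; apply/idP/idP; rewrite !inE /=.
    by rewrite (running_max_eq (zeta := xi)).
  by rewrite (running_max_eq (zeta := xi)).
apply: (maximal_inequality (F := F)) => //.
- move=> i i1n B mB; have [_ xw] := xia _ i1n; apply: (xw (clip @^-1` B)).
  by rewrite -[X in measurable X]setTI; exact: mclip.
- move=> i w _; rewrite /zeta /clip le_max lexx/= ge_max ge_min lexx/=.
  by rewrite andbT; lra.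
move=> i i1n A FA; have /andP[_ ni] := i1n.
have mA : measurable A by apply: Fm FA; rewrite (leq_trans (leq_pred _)).
have [Y [YF iY /(_ _ FA) YA] Y0] := xis _ i1n.
have mY : measurable_fun setT Y.
  move=> _ B mB; rewrite setTI; apply: (Fm i.-1); last exact: YF.
  by rewrite (leq_trans (leq_pred _)).
rewrite /Rintegral fine_le0//.
rewrite (_ : (\int[P]_(w in A) _ = \int[P]_(w in A) (xi i w)%:E)%E); last first.
  apply: ae_eq_integral => //.
  - by apply/measurable_EFinP; apply: measurable_funTS; exact: mzeta.
  - by apply/measurable_EFinP; apply: measurable_funTS; exact: mxi.
  - by apply: filterS (zeta_xi _ i1n) => w -> _.
(* [Y] is nonpositive only almost surely, so it is replaced by [- |Y|], which is nonpositive
   everywhere and has the same integral. *)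
rewrite -YA (_ : (\int[P]_(w in A) _ = \int[P]_(w in A) (- `|Y w|%:E))%E).
  by rewrite integral_ge0N// oppe_le0 integral_ge0.
apply: ae_eq_integral => //.
- by apply/measurable_EFinP; apply: measurable_funTS.
- apply: measurableT_comp => //; apply/measurable_EFinP; apply: measurable_funTS.
  exact: measurableT_comp.
- by apply: filterS Y0 => w Y0 _; rewrite ler0_norm// -EFinN opprK.
Qed.
Theorem corollary2p1 (R : realType) (d : measure_display)
    (T : measurableType d) (P : probability T R) (n : nat)
    (F : nat -> set (set T)) (xi : nat -> T -> R) (b : R)
    (n_ge1 : (1 <= n)%N) (F_filtration : is_filtration n F)
    (b_gt0 : 0 < b)
    (xi_bounded : forall i, (1 <= i <= n)%N ->
       {ae P, forall w, - b <= xi i w <= 1})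
    (xi_diff : martingale_differences P n F xi \/
       (b <= 1 /\ supermartingale_differences P n F xi))
    (x : R) (x_ge0 : 0 <= x) :
  (P [set w | (x <= running_max (partial_sum xi) n w)%R]
     <= (hoeffdingH n x (Num.sqrt (n%:R * b)))%:E)%E /\
  (P [set w | (x <= running_max (partial_sum xi) n w)%R]
     <= (expR (- (2 * x ^+ 2 / hoeffdingU n x b)))%:E)%E.
Proof.
have xi_super : supermartingale_differences P n F xi.
  case: xi_diff => [[xia xim]|[_ //]]; split => // i i1n.
  have [Y YE Y0] := xim i i1n; exists Y => //.
  by apply: filterS Y0 => w ->.
have mE : measurable [set w | (x <= running_max (partial_sum xi) n w)%R].
  apply: measurable_running_max_ge => // i i1n.
  by case: (xi_super.1 _ i1n) => /measurable_int/measurable_EFinP.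
rewrite -(fineK (fin_num_measure P _ mE)) !lee_fin.
(* All the probability is contained in this family of bounds; both conclusions follow by choosing
   [l]. *)
have bound l : 0 <= l -> fine (P [set w | (x <= running_max (partial_sum xi) n w)%R])
    <= expR (- (l * x)) * two_point_mgf b l ^+ n.
  move=> l0; rewrite -lee_fin fineK ?fin_num_measure//.
  exact: (maximal_inequality_ae _ n_ge1 F_filtration).
by split; [exact: le_hoeffdingH|exact: le_hoeffdingU].
Qed.
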